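(* Let $F:\mathbb{R}^d\to\mathbb{R}^d$ be $\frac1L$-cocoercive for some $L>0$, let $\mathbf{u}^*$ be a solution of the monotone inclusion problem for $F$ on $\mathbb{R}^d$, i.e. $F(\mathbf{u}^* )=\mathbf{0}$, and let $\epsilon>0$. Given an arbitrary (deterministic) $\mathbf{u}_0\in\mathbb{R}^d$, suppose that the iterates evolve according to the stochastic Halpern iteration $$\mathbf{u}_{k}=\lambda_{k}\mathbf{u}_0+(1-\lambda_{k})\Big(\mathbf{u}_{k-1}-\frac{2}{L_{k}}\widetilde F(\mathbf{u}_{k-1})\Big),\qquad k\ge 1,$$ where $L_k=2L$ and $\lambda_k=\frac1{k+1}$. Assume that the stochastic estimate is unbiased at $\mathbf{u}_0$, i.e. $\mathbb{E}[\widetilde F(\mathbf{u}_0)]=F(\mathbf{u}_0)$, that $\mathbb{E}[\|F(\mathbf{u}_0)-\widetilde F(\mathbf{u}_0)\|^2]\le\frac{\epsilon^2}{8}$, and that for all $k\ge1$, $\mathbb{E}[\|F(\mathbf{u}_k)-\widetilde F(\mathbf{u}_k)\|^2]\le\frac{\epsilon^2}{k}$. Then for all $k\ge 1$, $$\mathbb{E}[\|F(\mathbf{u}_k)\|]\le\frac{\Lambda_0}{k}+\Lambda_1\epsilon,$$ where $\Lambda_0=76L\|\mathbf{u}_0-\mathbf{u}^*\|$ and $\Lambda_1=4\sqrt{\tfrac23}$. As a result, the iteration returns a point $\mathbf{u}_k$ with $\mathbb{E}[\|F(\mathbf{u}_k)\|]\le4\epsilon$ after at most $N=\lceil\frac{2\Lambda_0}{\epsilon}\rceil=\mathcal{O}\big(\frac{L\|\mathbf{u}_0-\mathbf{u}^*\|}{\epsilon}\big)$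 iterations.
   Context: $\|\cdot\|$ is the norm on $\mathbb{R}^d$ induced by an inner product $\langle\cdot,\cdot\rangle$. $F$ is $\gamma$-cocoercive if $\langle F(\mathbf{u})-F(\mathbf{v}),\mathbf{u}-\mathbf{v}\rangle\ge\gamma\|F(\mathbf{u})-F(\mathbf{v})\|^2$ for all $\mathbf{u},\mathbf{v}\in\mathbb{R}^d$. $\widetilde F(\mathbf{u}_k)$ denotes a random vector (a possibly biased stochastic estimate of $F(\mathbf{u}_k)$) used at step $k$; apart from the stated assumptions it is arbitrary. A solution $\mathbf{u}^*$ is assumed to exist. $\mathcal{O}(\cdot)$ hides an absolute constant, in the regime of small $\epsilon$ (with $\mathbf{u}_0\neq\mathbf{u}^*$). *)

(* Defs.v *)
From HB Require Import structures.
From mathcomp Require Import all_boot all_order all_algebra.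
From mathcomp Require Import all_classical all_reals all_analysis.

Set Implicit Arguments.
Unset Strict Implicit.
Unset Printing Implicit Defensive.

Import Order.TTheory GRing.Theory Num.Theory.
Import numFieldNormedType.Exports.

Local Open Scope classical_set_scope.
Local Open Scope ring_scope.

(* The canonical norm of ['rV[R]_d] is the sup norm, so the norm induced by the
   inner product is defined separately. *)
Definition ipnorm (R : realType) (d : nat) (ip : {dot 'rV[R]_d for idfun})
    (x : 'rV[R]_d) : R :=
  Num.sqrt (ip x x).

Definition cocoercive (R : realType) (d : nat) (ip : {dot 'rV[R]_d for idfun})
    (gamma : R) (F : 'rV[R]_d -> 'rV[R]_d) : Prop :=
  forall u v : 'rV[R]_d,
    gamma * ipnorm ip (F u - F v) ^+ 2 <= ip (F u - F v) (u - v).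

(* Borel measurability of an R^d-valued map, coordinate by coordinate. *)
Definition random_vector (R : realType) (d : nat) (disp : measure_display)
    (T : measurableType disp) (X : T -> 'rV[R]_d) : Prop :=
  forall j : 'I_d, measurable_fun [set: T] (fun w => X w 0 j).

Definition has_mean (R : realType) (d : nat) (disp : measure_display)
    (T : measurableType disp) (P : probability T R) (X : T -> 'rV[R]_d)
    (m : 'rV[R]_d) : Prop :=
  forall j : 'I_d, 'E_P[fun w => (X w 0 j)%R]%E = (m 0 j)%:E.

(* [Ft k] is the estimate of [F (u k)] used to produce [u k.+1]; nothing relates
   the estimates of different steps. *)
Definition stochastic_halpern (R : realType) (d : nat) (T : Type)
    (lam Lk : nat -> R) (u0 : 'rV[R]_d) (Ft u : nat -> T -> 'rV[R]_d) : Prop :=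
  (forall w, u 0%N w = u0) /\
  (forall k w, u k.+1 w =
     lam k.+1 *: u0 + (1 - lam k.+1) *: (u k w - (2 / Lk k.+1) *: Ft k w)).

Definition Lambda0 (R : realType) (d : nat) (ip : {dot 'rV[R]_d for idfun})
    (L : R) (u0 ustar : 'rV[R]_d) : R :=
  76 * L * ipnorm ip (u0 - ustar).

Definition Lambda1 (R : realType) : R := 4 * Num.sqrt (2 / 3).

(* Main.v *)
Require Import Defs.
From HB Require Import structures.
From mathcomp Require Import all_boot all_order all_algebra.
From mathcomp Require Import all_classical all_reals all_analysis.
From mathcomp Require Import measurable_realfun.
From mathcomp Require Import ring lra.

Import Order.TTheory GRing.Theory Num.Theory.
Import numFieldNormedType.Exports.

Local Open Scope classical_set_scope.
Local Open Scope ring_scope.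

(** Write g_k = F u_k, e_k = g_k - Ft_k for the error of the k-th estimate, and
    M = L |u0 - ustar|.  The convergence of the noiseless Halpern iteration
    comes from the potential
      Phi_k = k (k + 1) |g_k|^2 + 2 L (k + 1) <g_k, u_k - u0>,
    which does not increase.  With noise, cocoercivity between consecutive
    iterates still gives ([potential_step])
      Phi_(k+1) <= Phi_k + 2 (k + 1) <e_k, g_k> + (k + 1) (k + 2) |e_k|^2,
    the point being that the error is paired with the old residual g_k: its
    pairing with g_(k+1) - g_k is absorbed by a square that cocoercivity
    leaves over.  Since F ustar = 0, cocoercivity also bounds Phi_k below by a
    multiple of k^2 |g_k|^2 minus a constant times M^2 ([potential_lower]).

    The errors are not centered for k >= 1, so <e_k, g_k> is split by Young's
    inequality with the weight 9 k, which grows with k: the part 9 k |e_k|^2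
    then contributes O(k^2 eps^2) to the sum because E |e_k|^2 <= eps^2 / k,
    while the part |g_k|^2 / (9 k) is summable enough to be handled by strong
    induction on the bound E |g_k|^2 <= 36 M^2 / k^2 + 10 eps^2
    ([sum_weighted_levels], [expected_sqr_residual]).  At k = 0 this weight
    degenerates; there the vector g_0 is deterministic and e_0 has mean 0, so
    the cross term vanishes in expectation.  Jensen's inequality gives
    E |g_k| <= 6 M / k + sqrt 10 eps, and 6 <= 76 and 10 <= 32/3.

    The inequalities are integrated only after being summed along a whole
    trajectory ([residual_bound]): every term but the centered one is then
    nonnegative, so measurability is enough to integrate them.  The residuals
    are measurable because F, being cocoercive, is Lipschitz
    ([measurable_lipschitz_comp]). *)

(** * Inner products on row vectors *)

Section InnerProduct.
Context {R : realType} {d : nat} (ip : {dot 'rV[R]_d for idfun}).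
Implicit Types x y z : 'rV[R]_d.

Lemma ipDl x y z : ip (x + y) z = ip x z + ip y z.
Proof. exact: linearDl. Qed.

Lemma ipDr x y z : ip z (x + y) = ip z x + ip z y.
Proof. exact: linearDr. Qed.

Lemma ipZl a x z : ip (a *: x) z = a * ip x z.
Proof. exact: linearZl_LR. Qed.

Lemma ipZr a x z : ip z (a *: x) = a * ip z x.
Proof. exact: linearZr_LR. Qed.

Lemma ipNl x z : ip (- x) z = - ip x z.
Proof. exact: linearNl. Qed.

Lemma ipNr x z : ip z (- x) = - ip z x.
Proof. exact: linearNr. Qed.

Lemma ipC x y : ip x y = ip y x.
Proof. by rewrite hermC mul1r. Qed.

Lemma ip_ge0 x : 0 <= ip x x.
Proof.
have [->|/neq0_dnorm_gt0/ltW//] := eqVneq x 0.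
by rewrite linear0l.
Qed.

Lemma ipnorm_ge0 x : 0 <= ipnorm ip x.
Proof. exact: sqrtr_ge0. Qed.

Lemma ipnormE x : ipnorm ip x ^+ 2 = ip x x.
Proof. by rewrite sqr_sqrtr// ip_ge0. Qed.

Lemma ipnorm0 : ipnorm ip 0 = 0.
Proof. by rewrite /ipnorm linear0l sqrtr0. Qed.

Lemma ipnormZ a x : ipnorm ip (a *: x) = `|a| * ipnorm ip x.
Proof.
by rewrite /ipnorm ipZl ipZr mulrA -expr2 sqrtrM ?sqr_ge0// sqrtr_sqr.
Qed.

Lemma ip_sqrB x y : ip (x - y) (x - y) = ip x x - 2 * ip x y + ip y y.
Proof.
rewrite !(ipDl, ipDr, ipNl, ipNr) (ipC y x).
ring.
Qed.

(** This is the expansion of [0 <= ip (c *: x - y) (c *: x - y)]. *)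
Lemma ip_young c x y : 0 < c -> 2 * ip x y <= c * ip x x + c^-1 * ip y y.
Proof.
move=> c0; have := ip_ge0 (c *: x - y).
rewrite ip_sqrB !(ipZl, ipZr) => h.
rewrite -subr_ge0 -(pmulr_rge0 _ c0).
suff -> : c * (c * ip x x + c^-1 * ip y y - 2 * ip x y) =
  c * (c * ip x x) - 2 * (c * ip x y) + ip y y by [].
by field; rewrite gt_eqF.
Qed.

Lemma ip_CauchySchwarz x y : `|ip x y| <= ipnorm ip x * ipnorm ip y.
Proof.
have [->|y0] := eqVneq y 0; first by rewrite linear0r normr0 ipnorm0 mulr0.
have yy0 : 0 < ip y y by exact: neq0_dnorm_gt0.
rewrite -sqrtr_sqr -sqrtrM ?ip_ge0// ler_wsqrtr//.
have := ip_ge0 (ip y y *: x - ip x y *: y).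
rewrite ip_sqrB !(ipZl, ipZr) => h.
rewrite -subr_ge0 -(pmulr_rge0 _ yy0); nra.
Qed.

Lemma ipnormD x y : ipnorm ip (x + y) <= ipnorm ip x + ipnorm ip y.
Proof.
rewrite -(@ler_pXn2r _ 2)// ?nnegrE ?addr_ge0 ?ipnorm_ge0//.
rewrite sqrrD !ipnormE ipDl !ipDr (ipC y x).
have := ip_CauchySchwarz x y; have := ler_norm (ip x y); lra.
Qed.

Lemma ipnorm_dist x y : `|ipnorm ip x - ipnorm ip y| <= ipnorm ip (x - y).
Proof.
have h a b : ipnorm ip a - ipnorm ip b <= ipnorm ip (a - b).
  by rewrite lerBlDr -{1}(subrK b a) ipnormD.
rewrite ler_norml h andbT lerNl opprB; apply: le_trans (h _ _) _.
by rewrite -(opprB x y) -scaleN1r ipnormZ normrN1 mul1r.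
Qed.

Lemma ipnorm_sum n (x : 'I_n -> 'rV[R]_d) :
  ipnorm ip (\sum_i x i) <= \sum_i ipnorm ip (x i).
Proof.
elim/big_ind2 : _ => [|a a' b b' h h'|//]; first by rewrite ipnorm0.
exact: le_trans (ipnormD _ _) (lerD h h').
Qed.

(** The easy half of the equivalence of norms: it transfers Lipschitz bounds
    from the inner-product norm to coordinates, where measurability is
    expressed. *)
Lemma ipnorm_le_coord x :
  ipnorm ip x <= (\sum_i ipnorm ip 'e_i) * \sum_i `|x 0 i|.
Proof.
rewrite {1}[x]row_sum_delta; apply: le_trans (ipnorm_sum _ _) _.
rewrite mulr_sumr; apply: ler_sum => i _; rewrite ipnormZ mulrC.
rewrite ler_wpM2r// (bigD1 i)//= lerDl sumr_ge0// => j _.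
exact: ipnorm_ge0.
Qed.

(** Cauchy-Schwarz on the right-hand side of cocoercivity, after dividing by
    the norm of [F x - F y]. *)
Lemma cocoercive_lipschitz (F : 'rV[R]_d -> 'rV[R]_d) (L : R) : 0 < L ->
  cocoercive ip L^-1 F ->
  forall x y, ipnorm ip (F x - F y) <= L * ipnorm ip (x - y).
Proof.
move=> L0 coF x y; have := coF x y.
have [->|n0] := eqVneq (ipnorm ip (F x - F y)) 0.
  by move=> _; rewrite mulr_ge0 ?ipnorm_ge0// ltW.
have {}n0 : 0 < ipnorm ip (F x - F y) by rewrite lt_def n0 ipnorm_ge0.
move=> h; have {h} := le_trans h (le_trans (ler_norm _) (ip_CauchySchwarz _ _)).
by rewrite expr2 mulrA mulrC ler_pM2l// ler_pdivrMl.
Qed.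

End InnerProduct.

(** * The potential along one step *)

Section Halpern.
Context {R : realType} {d : nat} (ip : {dot 'rV[R]_d for idfun}).
Implicit Types (u g e v w : 'rV[R]_d) (L n : R).

Definition potential L u0 n u g : R :=
  n * (n + 1) * ip g g + 2 * L * (n + 1) * ip g (u - u0).

(** The difference of the two sides is exactly
    [2 * L * (n + 1) * (n + 2)] times the slack of the cocoercivity inequality
    plus [(n + 1) * (n + 2)] times the square norm of [(g' - g) - (g - f)].
    That square is what lets the error act on [g] instead of [g']. *)
Lemma potential_step L n u0 u g u' g' f : 0 < L -> 0 <= n ->
  u' = (n + 2)^-1 *: u0 + (1 - (n + 2)^-1) *: (u - L^-1 *: f) ->
  L^-1 * ip (g' - g) (g' - g) <= ip (g' - g) (u' - u) ->
  potential L u0 (n + 1) u' g' <= potential L u0 n u g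
    + 2 * (n + 1) * ip (g - f) g + (n + 1) * (n + 2) * ip (g - f) (g - f).
Proof.
move=> L0 n0 u'E; rewrite /potential.
have n20 : n + 2 != 0 by rewrite gt_eqF//; lra.
pose e := g - f; pose w := u - u0.
have fE : f = g - e by rewrite /e opprB addrC subrK.
have uE : u = w + u0 by rewrite /w subrK.
have u'u0 : u' - u0 = ((n + 1) / (n + 2)) *: (w - L^-1 *: (g - e)).
  rewrite u'E -fE uE; apply/matrixP => i j; rewrite !mxE.
  by field; rewrite n20 gt_eqF.
have u'u : u' - u = ((n + 1) / (n + 2)) *: (w - L^-1 *: (g - e)) - w.
  by rewrite -u'u0 /w opprB addrA subrK.
rewrite u'u u'u0 -/e -/w ip_sqrB; clearbody e w.
have := ip_ge0 ip (g' - g - e).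
rewrite !(ipDl, ipDr, ipNl, ipNr, ipZl, ipZr) (ipC ip g g')
  (ipC ip e g) (ipC ip e g') => sq co.
have n12 : 0 <= (n + 1) * (n + 2).
  exact: mulr_ge0 (addr_ge0 n0 ler01) (addr_ge0 n0 (ler0n R 2)).
have L2 : 0 <= 2 * L by rewrite mulr_ge0// ltW.
have {}co := ler_wpM2l (mulr_ge0 L2 n12) co.
have {}sq := mulr_ge0 n12 sq.
rewrite -subr_ge0; rewrite -subr_ge0 in co.
have := addr_ge0 sq co; congr (0 <= _).
by field; rewrite n20 gt_eqF.
Qed.

End Halpern.

(** * Accumulated noise *)

Section Weights.
Context {R : realType}.
Implicit Types (k K : nat).

(** Coefficient of |e_k|^2 in the bound on twice the potential:
    [2 * (k + 1) * (k + 2)] from [potential_step] plus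
    [2 * (k + 1) * (9 * k)] from Young's inequality. *)
Definition noise_weight k : R := 4 * k.+1%:R * (5 * k%:R + 1).

(** Coefficient of |g_k|^2 left by Young's inequality; as [0^-1 = 0], it is 0
    at [k = 0], where the cross term is kept as it is. *)
Definition residual_weight k : R := 2 * k.+1%:R / (9 * k%:R).

Lemma noise_weight_ge0 k : 0 <= noise_weight k.
Proof. by rewrite !mulr_ge0// addr_ge0// mulr_ge0. Qed.

Lemma residual_weight_ge0 k : 0 <= residual_weight k.
Proof. by rewrite divr_ge0// mulr_ge0. Qed.

Definition noise_level (eps : R) k : R :=
  if k is 0%N then eps ^+ 2 / 8 else eps ^+ 2 / k%:R.

Definition residual_level (M eps : R) k : R :=
  36 * M ^+ 2 / k%:R ^+ 2 + 10 * eps ^+ 2.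

(** The increment of [sum_weighted_levels] is dominated by a telescoping one.
    For the terms in M this is [(n + 1) ^+ 2 <= 4 * n ^+ 2], with equality at
    [n = 1]; for those in eps the weight 9 in Young's inequality is small
    enough to leave the leading term at [20 * n]. *)
Lemma weighted_levels_step (M eps n : R) : 1 <= n ->
  4 * (n + 1) * (5 * n + 1) * (eps ^+ 2 / n)
    + 2 * (n + 1) / (9 * n) * (36 * M ^+ 2 / n ^+ 2 + 10 * eps ^+ 2)
  <= 32 * M ^+ 2 * (n^-1 - (n + 1)^-1) + 20 * (n + 2) * eps ^+ 2.
Proof.
move=> n1.
have n0 : 0 < n by lra.
have n10 : 0 < n + 1 by lra.
rewrite -subr_ge0.
have -> : 32 * M ^+ 2 * (n^-1 - (n + 1)^-1) + 20 * (n + 2) * eps ^+ 2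
  - (4 * (n + 1) * (5 * n + 1) * (eps ^+ 2 / n)
    + 2 * (n + 1) / (9 * n) * (36 * M ^+ 2 / n ^+ 2 + 10 * eps ^+ 2))
  = 8 * M ^+ 2 * ((3 * n + 1) * (n - 1)) / (n ^+ 3 * (n + 1))
    + eps ^+ 2 * (124 * n - 56) / (9 * n).
  by field; rewrite !gt_eqF.
by apply: addr_ge0; rewrite !(sqr_ge0, divr_ge0, mulr_ge0, exprn_ge0)//; lra.
Qed.

(** The inductive step on residual levels: if the residuals before [K] obey
    [residual_level], the accumulated bound gives it at [K]. The value 36 is
    what makes it close: past residuals return
    [32 * M ^+ 2] of the M-part, and [4 * M ^+ 2] comes from the initial
    distance. *)
Lemma sum_weighted_levels (M eps : R) K : (0 < K)%N ->
  4 * M ^+ 2 + \sum_(k < K) (noise_weight k * noise_level eps k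
    + residual_weight k * residual_level M eps k)
  <= K.+1%:R * K.+2%:R * residual_level M eps K.
Proof.
move=> K0.
suff : \sum_(k < K) (noise_weight k * noise_level eps k
    + residual_weight k * residual_level M eps k)
    <= 32 * M ^+ 2 * (1 - K%:R^-1) + 10 * (K%:R + 1) * (K%:R + 2) * eps ^+ 2.
  move=> h.
  have k0 : 0 < K%:R :> R by rewrite ltr0n.
  have -> : K.+1%:R * K.+2%:R * residual_level M eps K =
      36 * M ^+ 2 * (1 + (3 * K%:R + 2) / K%:R ^+ 2)
      + 10 * (K%:R + 1) * (K%:R + 2) * eps ^+ 2 :> R.
    rewrite /residual_level -!natr1.
    by field; rewrite gt_eqF.
  have : 0 <= 36 * M ^+ 2 * ((3 * K%:R + 2) / K%:R ^+ 2).
    by rewrite !(sqr_ge0, invr_ge0, mulr_ge0)//; lra.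
  have : 0 <= 32 * M ^+ 2 * K%:R^-1 by rewrite !(sqr_ge0, invr_ge0, mulr_ge0).
  lra.
case: K K0 => // K _.
elim: K => [|K IH].
  rewrite big_ord1 -[nat_of_ord _]/0%N.
  rewrite /noise_weight /noise_level /residual_weight.
  rewrite !mulr0n !mulr0 invr0 mulr0 mul0r invr1.
  have := sqr_ge0 eps; lra.
rewrite big_ord_recr /=.
have := @weighted_levels_step M eps K.+1%:R.
rewrite ler1n => /(_ erefl); move: IH.
rewrite /noise_weight /noise_level /residual_weight /residual_level.
rewrite -[K.+2%:R]natr1.
move: (K.+1%:R : R) => n.
set S := \sum_(k < _) _; set t := 4 * (n + 1) * _ * _ + _.
move: S t n^-1 (n + 1)^-1 => S t a b; lra.
Qed.

End Weights.

(** * Deterministic bound along a trajectory *)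

Section Trajectory.
Context {R : realType} {d : nat} (ip : {dot 'rV[R]_d for idfun}).
Context (F : 'rV[R]_d -> 'rV[R]_d) (L : R) (ustar u0 : 'rV[R]_d).
Hypotheses (L0 : 0 < L) (coF : cocoercive ip L^-1 F) (F0 : F ustar = 0).
Context (f u : nat -> 'rV[R]_d).
Hypothesis u0E : u 0%N = u0.
Hypothesis uS : forall k, u k.+1 =
  k.+2%:R^-1 *: u0 + (1 - k.+2%:R^-1) *: (u k - (2 / (2 * L)) *: f k).
Let g k := F (u k).
Let e k := F (u k) - f k.

Let Phi k := potential ip L u0 k%:R (u k) (g k).

Let PhiS k : Phi k.+1 <= Phi k + 2 * (k%:R + 1) * ip (e k) (g k)
    + (k%:R + 1) * (k%:R + 2) * ip (e k) (e k).
Proof.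
rewrite /Phi -natr1; apply: (potential_step _ _ _ _ _ _ _ _ (f k) L0) => //.
  have -> : L^-1 = 2 / (2 * L) by field; rewrite gt_eqF.
  by rewrite uS (_ : k.+2%:R = k%:R + 2 :> R)// -addn2 natrD.
by have := coF (u k.+1) (u k); rewrite ipnormE.
Qed.

Lemma potential_sum K : (0 < K)%N ->
  2 * Phi K <= 4 * ip (e 0%N) (F u0)
    + \sum_(k < K) (noise_weight k * ip (e k) (e k)
                    + residual_weight k * ip (g k) (g k)).
Proof.
case: K => // K _; elim: K => [|K IH].
  rewrite big_ord1 -[nat_of_ord _]/0%N; have := PhiS 0.
  rewrite /Phi {2}/potential /noise_weight /residual_weight /g u0E subrr.
  rewrite linear0r !mulr0 invr0; lra.
rewrite big_ord_recr /=.
have := PhiS K.+1.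
have c0 : 0 < 9 * K.+1%:R :> R by rewrite mulr_gt0.
have := ler_wpM2l (ler0n R K.+2) (ip_young ip _ (e K.+1) (g K.+1) c0).
move: IH; rewrite /noise_weight /residual_weight.
rewrite -[K.+2%:R]natr1.
set S := \sum_(k < _) _; set n : R := K.+1%:R.
move: S (ip (e K.+1) (e K.+1)) (ip (e K.+1) (g K.+1)) (ip (g K.+1) (g K.+1)).
by move: (9 * n)^-1 (Phi K.+1) (Phi K.+2) => c p p' S ee eg gg; lra.
Qed.

(** Cocoercivity between [u K] and [ustar] bounds the inner product of the
    residual with [u K - ustar] below; the remaining term, with
    [u0 - ustar], is split by Young's inequality so as to consume half of the
    square of the residual. *)
Lemma potential_lower K :
  K.+1%:R * K.+2%:R * ip (g K) (g K)
    <= 2 * Phi K + 4 * (L * ipnorm ip (u0 - ustar)) ^+ 2.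
Proof.
rewrite exprMn ipnormE /Phi /potential.
have co := coF (u K) ustar; rewrite F0 subr0 ipnormE -/(g K) in co.
rewrite (_ : u K - ustar = (u K - u0) + (u0 - ustar)) in co; last first.
  by rewrite addrA subrK.
rewrite ipDr in co.
set v := u0 - ustar in co *.
have k0 : 0 <= K%:R :> R by [].
have c0 : 0 < L^-1 * (K%:R + 2) / 2 by rewrite !mulr_gt0 ?invr_gt0//; lra.
have := ip_young ip _ (g K) v c0.
have := ip_ge0 ip v.
rewrite -[K.+2%:R]natr1 -natr1.
move: co; set n : R := K%:R in k0 c0 *; set gg := ip (g K) (g K).
set gw := ip (g K) (u K - u0); set gv := ip _ v; set vv := ip v v.
move=> co vv0 yo.
have L4 : 0 <= 4 * L by rewrite mulr_ge0// ltW.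
have L2 : 0 <= 2 * L by rewrite mulr_ge0// ltW.
have {}co := ler_wpM2l (mulr_ge0 L4 (addr_ge0 k0 ler01)) co.
have {}yo := ler_wpM2l (mulr_ge0 L2 (addr_ge0 k0 ler01)) yo.
(* what is lost when [(n + 1) / (n + 2)] is bounded by 1 *)
have vL : 0 <= 4 * L ^+ 2 * vv / (n + 2).
  by rewrite !(sqr_ge0, invr_ge0, mulr_ge0)//; lra.
rewrite -subr_ge0 in co; rewrite -subr_ge0 in yo; rewrite -subr_ge0.
have := addr_ge0 (addr_ge0 co yo) vL; congr (0 <= _).
have n20 : n + 2 != 0 by rewrite gt_eqF//; lra.
by field; rewrite n20 gt_eqF.
Qed.

Lemma residual_bound K : (0 < K)%N ->
  K.+1%:R * K.+2%:R * ip (g K) (g K)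
    <= 4 * (L * ipnorm ip (u0 - ustar)) ^+ 2 + 4 * ip (e 0%N) (F u0)
    + \sum_(k < K) (noise_weight k * ip (e k) (e k)
                    + residual_weight k * ip (g k) (g k)).
Proof.
by move=> K0; have := potential_lower K; have := potential_sum _ K0; lra.
Qed.

End Trajectory.

(** * Measurability of Lipschitz functions of a random vector *)

Section Measurability.
Context {R : realType} {d : nat} {disp : measure_display}
  {T : measurableType disp}.
Implicit Types X Y : T -> 'rV[R]_d.

Lemma measurable_fun_countable_val {I : countType} (Z : T -> I) (h : I -> R) :
  (forall i, measurable (Z @^-1` [set i])) ->
  measurable_fun [set: T] (h \o Z).
Proof.
move=> mZ _ B mB; rewrite setTI.
have -> : (h \o Z) @^-1` B = \bigcup_(i in h @^-1` B) Z @^-1` [set i].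
  by apply/seteqP; split=> [w Bw|w /= [i Bi ->//]]; exists (Z w).
rewrite bigcup_mkcond; apply: countable_bigcupT_measurable => // i.
by case: ifP.
Qed.

Definition grid (n : nat) (x : 'rV[R]_d) : 'rV[int]_d :=
  \row_j Num.floor (n.+1%:R * x 0 j).

Definition grid_point (n : nat) (z : 'rV[int]_d) : 'rV[R]_d :=
  \row_j ((z 0 j)%:~R / n.+1%:R).

Lemma grid_point_close n (x : 'rV[R]_d) j :
  `|x 0 j - grid_point n (grid n x) 0 j| <= n.+1%:R^-1.
Proof.
have n0 : 0 < n.+1%:R :> R by [].
have /andP[h1 h2] := floor_itv (n.+1%:R * x 0 j).
rewrite !mxE; set z := (Num.floor _)%:~R in h1 *.
have -> : x 0 j - z / n.+1%:R = (n.+1%:R * x 0 j - z) * n.+1%:R^-1.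
  by field; rewrite gt_eqF.
rewrite ger0_norm ?mulr_ge0 ?invr_ge0 ?subr_ge0//.
rewrite ler_piMl ?invr_ge0//.
by rewrite lerBlDl; move: h2; rewrite intrD -/z => /ltW.
Qed.

Lemma measurable_grid n X (z : 'rV[int]_d) : random_vector X ->
  measurable ((grid n \o X) @^-1` [set z]).
Proof.
move=> mX.
have -> : (grid n \o X) @^-1` [set z] =
  \bigcap_(j in [set: 'I_d]) ((fun w => n.+1%:R * X w 0 j) @^-1`
     `[(z 0 j)%:~R, (z 0 j)%:~R + 1[).
  apply/seteqP; split=> [w /= zE j _|w /= h].
    rewrite /= in_itv /= -zE mxE.
    by have := floor_itv (n.+1%:R * X w 0 j); rewrite intrD.
  apply/rowP => j; rewrite mxE.
  have := h j I; rewrite /= in_itv /= => hj.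
  by apply: floor_def; rewrite intrD.
apply: fin_bigcap_measurable => // j _.
rewrite -[X in measurable X]setTI.
apply: (measurable_funM (measurable_cst _) (mX j)) => //.
Qed.

(** Measurability of [X] is only known coordinate by coordinate, so the proof
    rounds every coordinate down to a multiple of [n.+1%:R^-1]. The rounded
    vector takes countably many values, on events that are finite
    intersections of coordinate events, so any function of it is measurable;
    the Lipschitz bound makes these functions converge to [h \o X]. *)
Lemma measurable_lipschitz_comp (c : R) (h : 'rV[R]_d -> R) X :
  (forall x y, `|h x - h y| <= c * \sum_j `|x 0 j - y 0 j|) ->
  random_vector X -> measurable_fun [set: T] (h \o X).
Proof.
move=> hlip mX.
apply: (@measurable_fun_cvg _ _ _ _
  (fun n => (h \o grid_point n) \o (grid n \o X))) => [n|w _].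
  by apply: measurable_fun_countable_val => z; exact: measurable_grid.
have c0 : 0 <= `|c| * d%:R by rewrite mulr_ge0.
have close n : `|h (X w) - h (grid_point n (grid n (X w)))| <=
    (`|c| * d%:R) * n.+1%:R^-1.
  apply: le_trans (hlip _ _) _.
  apply: (@le_trans _ _ (`|c| * \sum_j
      `|X w 0 j - grid_point n (grid n (X w)) 0 j|)).
    by rewrite ler_wpM2r ?ler_norm ?sumr_ge0.
  rewrite -mulrA ler_wpM2l//.
  apply: le_trans (ler_sum _ (fun j _ => grid_point_close n (X w) j)) _.
  by rewrite sumr_const card_ord mulr_natl.
have lim0 : (`|c| * d%:R) * n.+1%:R^-1 @[n --> \oo] --> (0 : R).
  rewrite -[X in _ --> X](mulr0 (`|c| * d%:R)).
  by apply: cvgMl_tmp; exact: cvg_harmonic.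
apply/cvgrPdist_le => eps eps0.
have /cvgrPdist_le/(_ _ eps0) := lim0.
apply: filterS => n /=; rewrite sub0r normrN => hn.
exact: le_trans (close n) (le_trans (ler_norm _) hn).
Qed.

End Measurability.

Section RandomVectors.
Context {R : realType} {d : nat} (ip : {dot 'rV[R]_d for idfun})
  {disp : measure_display} {T : measurableType disp}.
Implicit Types X Y : T -> 'rV[R]_d.

Section Lipschitz.
Context (F : 'rV[R]_d -> 'rV[R]_d) (c : R).
Hypotheses (c0 : 0 <= c)
  (Flip : forall x y, ipnorm ip (F x - F y) <= c * ipnorm ip (x - y)).

Let coordlip x y : ipnorm ip (F x - F y)
  <= c * (\sum_i ipnorm ip 'e_i) * \sum_i `|x 0 i - y 0 i|.
Proof.
apply: le_trans (Flip x y) _; rewrite -mulrA ler_wpM2l//.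
apply: le_trans (ipnorm_le_coord ip (x - y)) _.
rewrite ler_wpM2l ?sumr_ge0// => [i _|]; first exact: ipnorm_ge0.
by apply: ler_sum => i _; rewrite !mxE.
Qed.

Lemma measurable_ipnorm X : random_vector X ->
  measurable_fun [set: T] (fun w => ipnorm ip (F (X w))).
Proof.
apply: (measurable_lipschitz_comp _ (fun x => ipnorm ip (F x))) => x y.
exact: le_trans (ipnorm_dist _ _ _) (coordlip x y).
Qed.

Lemma measurable_ip_vector X v : random_vector X ->
  measurable_fun [set: T] (fun w => ip (F (X w)) v).
Proof.
apply: (measurable_lipschitz_comp
  (ipnorm ip v * (c * (\sum_i ipnorm ip 'e_i))) (fun x => ip (F x) v)) => x y.
rewrite -(linearBl ip) -mulrA.
apply: le_trans (ip_CauchySchwarz _ _ _) _.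
by rewrite mulrC ler_wpM2l ?ipnorm_ge0.
Qed.

End Lipschitz.

(** The inner product with the random [Y] is expanded in the coordinates of
    [Y], which leaves only inner products of [F (X w)] with fixed vectors. *)
Lemma measurable_sqdist (F : 'rV[R]_d -> 'rV[R]_d) (c : R) X Y :
  0 <= c ->
  (forall x y, ipnorm ip (F x - F y) <= c * ipnorm ip (x - y)) ->
  random_vector X -> random_vector Y ->
  measurable_fun [set: T] (fun w => ip (F (X w) - Y w) (F (X w) - Y w)).
Proof.
move=> c0 Flip mX mY.
have id1 (x y : 'rV[R]_d) : ipnorm ip (id x - id y) <= 1 * ipnorm ip (x - y).
  by rewrite mul1r.
have -> : (fun w => ip (F (X w) - Y w) (F (X w) - Y w)) = (fun w =>
    ipnorm ip (F (X w)) ^+ 2 - 2 * (\sum_j Y w 0 j * ip (F (X w)) 'e_j)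
    + ipnorm ip (Y w) ^+ 2).
  apply/funext => w; rewrite ip_sqrB !ipnormE; congr (_ - 2 * _ + _).
  rewrite {1}[Y w]row_sum_delta linear_sumr; apply: eq_bigr => j _.
  exact: ipZr.
apply: measurable_funD; last first.
  by apply: measurable_funX; exact: (measurable_ipnorm id 1 ler01 id1).
apply: measurable_funB.
  by apply: measurable_funX; exact: (measurable_ipnorm F c).
apply: measurable_funM => //; apply: measurable_sum => j.
apply: measurable_funM; first exact: mY.
exact: (measurable_ip_vector F c).
Qed.

Lemma random_vector_halpern (lam Lk : nat -> R) (u0 : 'rV[R]_d)
    (Ft u : nat -> T -> 'rV[R]_d) :
  (forall k, random_vector (Ft k)) -> stochastic_halpern lam Lk u0 Ft u ->
  forall k, random_vector (u k).
Proof.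
move=> mFt [u0E uS]; elim=> [|k IH] j.
  rewrite (_ : (fun w => u 0%N w 0 j) = cst (u0 0 j)).
    exact: measurable_cst.
  by apply/funext => w; rewrite u0E.
rewrite (_ : (fun w => u k.+1 w 0 j) = (fun w => lam k.+1 * u0 0 j
    + (1 - lam k.+1) * (u k w 0 j - 2 / Lk k.+1 * Ft k w 0 j))); last first.
  by apply/funext => w; rewrite uS !mxE.
apply: measurable_funD => //; apply: measurable_funM => //.
apply: measurable_funB; first exact: IH.
by apply: measurable_funM => //; exact: mFt.
Qed.

End RandomVectors.

(** * Upper bounds on expectations *)

Section Expectation.
Context {R : realType} {disp : measure_display} {T : measurableType disp}
  (P : probability T R).
Implicit Types X Y Z : T -> R.
Local Open Scope ereal_scope.

Lemma expectation_int X : 'E_P[X] = \int[P]_w (X w)%:E.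
Proof. by rewrite unlock. Qed.

(** A real-valued expectation excludes infinite positive and negative parts:
    were both infinite, their difference would be [-oo] by convention. *)
Lemma expectation_finite_integrable X (r : R) :
  measurable_fun [set: T] X -> 'E_P[X] = r%:E ->
  P.-integrable [set: T] (EFin \o X).
Proof.
move=> mX EX; apply/integrableP; split; first exact/measurable_EFinP.
by rewrite integral_fin_num_abs// -expectation_int EX.
Qed.

Lemma ge0_expectation_mono X Y :
  measurable_fun [set: T] X -> measurable_fun [set: T] Y ->
  (forall w, 0 <= X w)%R -> (forall w, X w <= Y w)%R -> 'E_P[X] <= 'E_P[Y].
Proof.
move=> mX mY X0 XY; rewrite !expectation_int.
apply: ge0_le_integral => //; try exact/measurable_EFinP.
- by move=> w _; rewrite lee_fin.
- by move=> w _; rewrite lee_fin.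
Qed.

Lemma ge0_expectationD_le X Y (x y : R) :
  measurable_fun [set: T] X -> measurable_fun [set: T] Y ->
  (forall w, 0 <= X w)%R -> (forall w, 0 <= Y w)%R ->
  'E_P[X] <= x%:E -> 'E_P[Y] <= y%:E ->
  'E_P[fun w => (X w + Y w)%R] <= (x + y)%R%:E.
Proof.
move=> mX mY X0 Y0; rewrite !expectation_int => Xx Yy.
under eq_integral do rewrite EFinD.
rewrite ge0_integralD//; try exact/measurable_EFinP.
- by rewrite EFinD leeD.
- by move=> w _; rewrite lee_fin.
- by move=> w _; rewrite lee_fin.
Qed.

Lemma ge0_expectationZ_le (a : R) X (x : R) :
  (0 <= a)%R -> measurable_fun [set: T] X -> (forall w, 0 <= X w)%R ->
  'E_P[X] <= x%:E -> 'E_P[fun w => (a * X w)%R] <= (a * x)%R%:E.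
Proof.
move=> a0 mX X0; rewrite !expectation_int => Xx.
under eq_integral do rewrite EFinM.
rewrite ge0_integralZl//; first by rewrite EFinM lee_wpmul2l.
- exact/measurable_EFinP.
- by move=> w _; rewrite lee_fin.
Qed.

Lemma ge0_expectation_sum_le (K : nat) (X : nat -> T -> R) (x : nat -> R) :
  (forall k, measurable_fun [set: T] (X k)) ->
  (forall k w, 0 <= X k w)%R ->
  (forall k, (k < K)%N -> 'E_P[X k] <= (x k)%:E) ->
  'E_P[fun w => (\sum_(k < K) X k w)%R] <= (\sum_(k < K) x k)%R%:E.
Proof.
move=> mX X0; elim: K => [|K IH] Xx.
  under eq_fun do rewrite big_ord0.
  by rewrite big_ord0 expectation_cst.
under eq_fun do rewrite big_ord_recr /=.
rewrite big_ord_recr /=; apply: ge0_expectationD_le => //.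
- exact: measurable_sum.
- by move=> w; rewrite sumr_ge0.
- by apply: IH => k kK; apply: Xx; rewrite ltnS ltnW.
- exact: Xx.
Qed.

(** The centered part [Z] may change sign, so it is [Z] and [Y] that must be
    integrable to split the expectation of their sum; [X] is only bounded. *)
Lemma expectation_le_centered X Y Z (y : R) :
  measurable_fun [set: T] X -> measurable_fun [set: T] Y ->
  measurable_fun [set: T] Z ->
  (forall w, 0 <= X w)%R -> (forall w, 0 <= Y w)%R ->
  'E_P[Z] = 0 -> 'E_P[Y] <= y%:E -> (forall w, X w <= Z w + Y w)%R ->
  'E_P[X] <= y%:E.
Proof.
move=> mX mY mZ X0 Y0 Z0 Yy XZY.
have EY0 : 0 <= 'E_P[Y] by exact: expectation_ge0.
have EYfin : 'E_P[Y] = (fine 'E_P[Y])%:E.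
  by rewrite fineK// ge0_fin_numE//; exact: le_lt_trans Yy (ltry _).
have iY := expectation_finite_integrable _ _ mY EYfin.
have iZ : P.-integrable [set: T] (EFin \o Z).
  exact: (expectation_finite_integrable _ _ mZ Z0).
apply: (le_trans (ge0_expectation_mono _ _ mX (measurable_funD mZ mY) X0 XZY)).
rewrite expectation_int.
under eq_integral do rewrite EFinD.
by rewrite integralD// -!expectation_int Z0 add0e.
Qed.

(** Jensen's inequality for the square, obtained by integrating the tangent
    bound [X <= c / 2 + X ^+ 2 / (2 * c)], an equality at [X = c]. *)
Lemma expectation_le_of_sqr X (c : R) : (0 < c)%R ->
  measurable_fun [set: T] X -> (forall w, 0 <= X w)%R ->
  'E_P[fun w => (X w ^+ 2)%R] <= (c ^+ 2)%R%:E -> 'E_P[X] <= c%:E.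
Proof.
move=> c0 mX X0 X2.
have mX2 : measurable_fun [set: T] (fun w => (X w ^+ 2)%R).
  exact: measurable_funX.
have i0 : (0 <= (2 * c)^-1 :> R)%R by rewrite invr_ge0 mulr_ge0// ltW.
apply: (@le_trans _ _ 'E_P[fun w => (c / 2 + (2 * c)^-1 * X w ^+ 2)%R]).
  apply: ge0_expectation_mono => //.
    by apply: measurable_funD => //; exact: measurable_funM.
  move=> w; rewrite -subr_ge0.
  suff -> : (c / 2 + (2 * c)^-1 * X w ^+ 2 - X w)%R
      = ((2 * c)^-1 * (X w - c) ^+ 2)%R by rewrite mulr_ge0// sqr_ge0.
  by field; rewrite gt_eqF.
have -> : c%:E = (c / 2 + (2 * c)^-1 * c ^+ 2)%R%:E :> \bar R.
  by congr EFin; field; rewrite gt_eqF.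
apply: ge0_expectationD_le => //.
- exact: measurable_funM.
- by move=> w; rewrite divr_ge0// ltW.
- by move=> w; rewrite mulr_ge0// sqr_ge0.
- by rewrite expectation_cst.
- by apply: ge0_expectationZ_le => // w; rewrite sqr_ge0.
Qed.

Lemma expectation_ip_centered (d : nat) (ip : {dot 'rV[R]_d for idfun})
    (X : T -> 'rV[R]_d) (m v : 'rV[R]_d) :
  random_vector X -> has_mean P X m ->
  measurable_fun [set: T] (fun w => ip (m - X w)%R v)
  /\ 'E_P[fun w => ip (m - X w)%R v] = 0.
Proof.
move=> mX EX.
have ipE : (fun w => ip (m - X w)%R v) =
    (fun w => \sum_j (m 0 j - X w 0 j) * ip 'e_j v)%R.
  apply/funext => w; rewrite [(m - X w)%R]row_sum_delta linear_sumlz.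
  by apply: eq_bigr => j _; rewrite !mxE; exact: ipZl.
have mD j : measurable_fun [set: T] (fun w => (m 0 j - X w 0 j) * ip 'e_j v)%R.
  by apply: measurable_funM => //; apply: measurable_funB => //; exact: mX.
rewrite ipE; split; first by apply: measurable_sum => j; exact: mD.
have iX j : P.-integrable [set: T] (fun w => (X w 0 j)%:E).
  exact: (expectation_finite_integrable _ _ (mX j) (EX j)).
have im j : P.-integrable [set: T] (fun=> (m 0 j)%:E).
  exact: finite_measure_integrable_cst.
rewrite expectation_int.
under eq_integral do rewrite -sumEFin.
have iD j : P.-integrable [set: T] (fun w => ((m 0 j - X w 0 j)%R%:E)).
  have := integrableB measurableT (im j) (iX j).
  by apply: eq_integrable => // w _; rewrite EFinB.
rewrite integral_sum//; last first.
  move=> j; have := integrableZr measurableT (ip 'e_j v) (iD j).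
  by apply: eq_integrable => // w _; rewrite EFinM.
rewrite big1// => j _.
under eq_integral do rewrite EFinM.
rewrite integralZr//.
under eq_integral do rewrite EFinB.
rewrite integralB//.
have -> : \int[P]_w (X w 0%R j)%:E = (m 0%R j)%:E.
  by rewrite -(EX j) expectation_int.
by rewrite -expectation_int expectation_cst subee// mul0e.
Qed.

End Expectation.

(** * The stochastic iteration *)

Section StochasticHalpern.
Context {R : realType} {d : nat} (ip : {dot 'rV[R]_d for idfun})
  {disp : measure_display} {T : measurableType disp} (P : probability T R).
Context (F : 'rV[R]_d -> 'rV[R]_d) (L eps : R) (ustar u0 : 'rV[R]_d)
  (Ft u : nat -> T -> 'rV[R]_d).
Hypotheses (L0 : 0 < L) (coF : cocoercive ip L^-1 F) (F0 : F ustar = 0)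
  (mFt : forall k, random_vector (Ft k))
  (uH : stochastic_halpern (fun k => k.+1%:R^-1) (fun _ => 2 * L) u0 Ft u)
  (meanFt : has_mean P (Ft 0%N) (F u0))
  (noiseFt : forall k,
    ('E_P[fun w => ip (F (u k w) - Ft k w)%R (F (u k w) - Ft k w)%R]
       <= (noise_level eps k)%:E)%E).

Let M := L * ipnorm ip (u0 - ustar).
Let sqres k w := ip (F (u k w)) (F (u k w)).
Let sqerr k w := ip (F (u k w) - Ft k w) (F (u k w) - Ft k w).

Let Flip := cocoercive_lipschitz ip F L L0 coF.

Let mu k : random_vector (u k) := random_vector_halpern _ _ _ _ _ mFt uH k.

Lemma measurable_residual k :
  measurable_fun [set: T] (fun w => ipnorm ip (F (u k w))).
Proof. exact: (measurable_ipnorm ip F L (ltW L0) Flip). Qed.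

Let msqres k : measurable_fun [set: T] (sqres k).
Proof.
rewrite (_ : sqres k = fun w => ipnorm ip (F (u k w)) ^+ 2); last first.
  by apply/funext => w; rewrite ipnormE.
by apply: measurable_funX; exact: measurable_residual.
Qed.

Let msqerr k : measurable_fun [set: T] (sqerr k).
Proof. exact: (measurable_sqdist ip F L _ _ (ltW L0) Flip (mu k) (mFt k)). Qed.

(** The trajectory bound is integrated: the cross term at step 0 has mean 0,
    and the residuals of earlier steps are bounded by the induction
    hypothesis. The residual at step 0, which that hypothesis leaves out,
    enters with weight 0. *)
Lemma expected_sqr_residual K : (0 < K)%N ->
  ('E_P[sqres K] <= (residual_level M eps K)%:E)%E.
Proof.
elim/ltn_ind: K => K IH K0.
pose G k w := noise_weight k * sqerr k w + residual_weight k * sqres k w.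
pose lev k := noise_weight k * noise_level eps k
  + residual_weight k * residual_level M eps k : R.
have sqres0 k w : 0 <= sqres k w by exact: ip_ge0.
have sqerr0 k w : 0 <= sqerr k w by exact: ip_ge0.
have mG k : measurable_fun [set: T] (G k).
  by apply: measurable_funD; apply: measurable_funM.
have G0 k w : 0 <= G k w.
  by rewrite addr_ge0 ?mulr_ge0 ?noise_weight_ge0 ?residual_weight_ge0.
have EG k : (k < K)%N -> ('E_P[G k] <= (lev k)%:E)%E.
  move=> kK; apply: ge0_expectationD_le.
  - exact: measurable_funM.
  - exact: measurable_funM.
  - by move=> w; rewrite mulr_ge0 ?noise_weight_ge0.
  - by move=> w; rewrite mulr_ge0 ?residual_weight_ge0.
  - apply: ge0_expectationZ_le => //; last exact: noiseFt.
    exact: noise_weight_ge0.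
  - case: k kK => [|k] kK.
      rewrite /residual_weight mulr0 invr0 mulr0 mul0r.
      by under eq_fun do rewrite mul0r; rewrite expectation_cst.
    by apply: ge0_expectationZ_le => //; [exact: residual_weight_ge0|exact: IH].
have [mZ EZ] := expectation_ip_centered P _ ip _ _ (4 *: F u0) (mFt 0%N) meanFt.
have c0 : 0 < K.+1%:R * K.+2%:R :> R by rewrite mulr_gt0.
have mS : measurable_fun [set: T] (fun w => \sum_(k < K) G k w).
  by apply: measurable_sum => k.
have S0 w : 0 <= \sum_(k < K) G k w by rewrite sumr_ge0.
have M0 : 0 <= 4 * M ^+ 2 by rewrite mulr_ge0// sqr_ge0.
have main : ('E_P[fun w => (K.+1%:R * K.+2%:R * sqres K w)%R]
    <= (K.+1%:R * K.+2%:R * residual_level M eps K)%R%:E)%E.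
  apply: (expectation_le_centered P _ (fun w => 4 * M ^+ 2 + \sum_(k < K) G k w)
    _ _ _ _ mZ _ _ EZ).
  - exact: measurable_funM.
  - exact: measurable_funD.
  - by move=> w; rewrite mulr_ge0// ltW.
  - by move=> w; rewrite addr_ge0.
  - apply: (@le_trans _ _ (4 * M ^+ 2 + \sum_(k < K) lev k)%:E).
      apply: ge0_expectationD_le => //; first by rewrite expectation_cst.
      exact: ge0_expectation_sum_le.
    by rewrite lee_fin; exact: sum_weighted_levels.
  - move=> w; have [u0E uS] := uH.
    have := residual_bound ip F L ustar u0 L0 coF F0 (fun k => Ft k w)
      (fun k => u k w) (u0E w) (fun k => uS k w) K K0.
    rewrite u0E ipZr -/M => h; apply: le_trans h _.
    by rewrite [X in _ <= X]addrA [X in _ <= X + _]addrC.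
have := ge0_expectationZ_le P (K.+1%:R * K.+2%:R)^-1 _ _ _ _ _ main.
rewrite invr_ge0 ltW//.
move=> /(_ erefl (measurable_funM (measurable_cst _) (msqres K))).
rewrite mulKf ?gt_eqF//.
under eq_fun do rewrite mulKf ?gt_eqF//.
by apply => w; rewrite mulr_ge0// ltW.
Qed.

Lemma expected_residual K : 0 < eps -> (0 < K)%N ->
  ('E_P[fun w => ipnorm ip (F (u K w))]
     <= (Lambda0 ip L u0 ustar / K%:R + Lambda1 R * eps)%:E)%E.
Proof.
move=> eps0 K0.
have k0 : 0 < K%:R :> R by rewrite ltr0n.
have M0 : 0 <= M by rewrite mulr_ge0 ?ipnorm_ge0// ltW.
pose s : R := Num.sqrt (2 / 3).
have s0 : 0 <= s by exact: sqrtr_ge0.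
have s2 : s ^+ 2 = 2 / 3 by rewrite sqr_sqrtr// divr_ge0.
have LE : Lambda0 ip L u0 ustar / K%:R + Lambda1 R * eps
    = 76 * (M / K%:R) + 4 * s * eps.
  by rewrite /Lambda0 /Lambda1 -/s /M; ring.
have x0 : 0 <= M / K%:R by rewrite divr_ge0// ltW.
have s1 : 0 < s by rewrite sqrtr_gt0 divr_gt0.
apply: expectation_le_of_sqr.
- by rewrite LE; have := mulr_gt0 s1 eps0; lra.
- exact: measurable_residual.
- by move=> w; exact: ipnorm_ge0.
under eq_fun do rewrite ipnormE.
apply: le_trans (expected_sqr_residual _ K0) _.
rewrite lee_fin LE /residual_level -mulrA -expr_div_n.
set x := M / K%:R in x0 *.
have -> : (76 * x + 4 * s * eps) ^+ 2 =
    5776 * x ^+ 2 + 608 * (s * eps * x) + 16 * s ^+ 2 * eps ^+ 2 by ring.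
rewrite s2.
have : 0 <= s * eps * x by exact: mulr_ge0 (mulr_ge0 s0 (ltW eps0)) x0.
have := sqr_ge0 eps; have := sqr_ge0 x.
lra.
Qed.

End StochasticHalpern.

(** Once [eps <= a], rounding up costs at most [1 <= a / eps]. *)
Lemma near0_ceil_le {R : realType} (a : R) : 0 < a ->
  \forall eps \near 0^'+, (Num.ceil (152 * a / eps))%:~R <= 153 * (a / eps).
Proof.
move=> a0; near=> eps.
have eps0 : 0 < eps by near: eps; exact: nbhs_right_gt.
have epsa : eps <= a by near: eps; exact: nbhs_right_le.
have : 1 <= a / eps by rewrite ler_pdivlMr ?mul1r.
have := ceil_itv (152 * a / eps); rewrite intrB -mulrA => /andP[h _].
move: h; lra.
Unshelve. all: by end_near. Qed.

Theorem theorem3p1 (R : realType) :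
  exists C : R, 0 < C /\
  forall (d : nat) (ip : {dot 'rV[R]_d for idfun})
    (F : 'rV[R]_d -> 'rV[R]_d) (L : R) (ustar u0 : 'rV[R]_d),
  0 < L -> cocoercive ip L^-1 F -> F ustar = 0 ->
  (forall (eps : R) (disp : measure_display) (T : measurableType disp)
     (P : probability T R) (Ft u : nat -> T -> 'rV[R]_d),
   0 < eps ->
   (forall k, random_vector (Ft k)) ->
   stochastic_halpern (fun k => k.+1%:R^-1) (fun _ => 2 * L) u0 Ft u ->
   has_mean P (Ft 0%N) (F u0) ->
   ('E_P[fun w => (ipnorm ip (F u0 - Ft 0%N w) ^+ 2)%R]
      <= (eps ^+ 2 / 8)%R%:E)%E ->
   (forall k : nat, (1 <= k)%N ->
      ('E_P[fun w => (ipnorm ip (F (u k w) - Ft k w) ^+ 2)%R]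
         <= (eps ^+ 2 / k%:R)%R%:E)%E) ->
   (forall k : nat, (1 <= k)%N ->
      ('E_P[fun w => ipnorm ip (F (u k w))]
         <= (Lambda0 ip L u0 ustar / k%:R + Lambda1 R * eps)%R%:E)%E) /\
   (exists k : nat, k%:Z <= Num.ceil (2 * Lambda0 ip L u0 ustar / eps) /\
      ('E_P[fun w => ipnorm ip (F (u k w))]
         <= (4 * eps)%R%:E)%E)) /\
  (u0 != ustar ->
   \forall eps \near 0^'+,
     (Num.ceil (2 * Lambda0 ip L u0 ustar / eps))%:~R
       <= C * (L * ipnorm ip (u0 - ustar) / eps)).
Proof.
exists 153; split=> // d ip F L ustar u0 L0 coF F0.
have L0E : 2 * Lambda0 ip L u0 ustar = 152 * (L * ipnorm ip (u0 - ustar)).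
  by rewrite /Lambda0; ring.
have dist_gt0 : u0 != ustar -> 0 < L * ipnorm ip (u0 - ustar).
  by move=> ne; rewrite mulr_gt0// sqrtr_gt0 neq0_dnorm_gt0// subr_eq0.
split; last first.
  by move=> /dist_gt0/near0_ceil_le; rewrite L0E.
move=> eps disp T P Ft u eps0 mFt uH meanFt noise0 noiseS.
have noiseFt k :
    ('E_P[fun w => ip (F (u k w) - Ft k w)%R (F (u k w) - Ft k w)%R]
      <= (noise_level eps k)%:E)%E.
  under eq_fun do rewrite -ipnormE.
  case: k => [|k]; last exact: noiseS.
  by under eq_fun do rewrite uH.1.
have bound K := expected_residual ip P F L eps ustar u0 Ft u L0 coF F0 mFt uH
  meanFt noiseFt K eps0.
split=> //.
(* if [u0 = ustar] the iteration budget is 0, and [u 0] is already a solution *)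
have [u0E|/dist_gt0 a0] := eqVneq u0 ustar.
  exists 0%N; split.
    by rewrite L0E u0E subrr ipnorm0 !mulr0 mul0r ceil0.
  under eq_fun do rewrite uH.1 u0E F0 ipnorm0.
  by rewrite expectation_cst lee_fin mulr_ge0// ltW.
set x := 2 * _ / eps.
have x0 : 0 < x by rewrite divr_gt0// L0E mulr_gt0.
have c0 : 0 < Num.ceil x by rewrite ceil_gt0.
case NE : (Num.ceil x) c0 => [N|//] N0.
exists N; split=> //; apply: le_trans (bound N N0) _.
rewrite lee_fin.
have N0' : 0 < N%:R :> R by rewrite ltr0n.
have xN : x <= N%:R by have := ceil_ge x; rewrite NE.
have hN : Lambda0 ip L u0 ustar / N%:R <= eps / 2.
  rewrite ler_pdivrMr//; move: xN; rewrite ler_pdivrMr//; lra.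
(* [hN] spends [eps / 2], so [4 * sqrt (2 / 3)] may be at most 7/2 *)
have hs : Num.sqrt (2 / 3) <= 7 / 8 :> R.
  have := sqrtr_ge0 (2 / 3 : R).
  have : Num.sqrt (2 / 3) ^+ 2 = 2 / 3 :> R by rewrite sqr_sqrtr// divr_ge0.
  nra.
have := ler_wpM2r (ltW eps0) hs; rewrite /Lambda1; lra.
Qed.
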